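(* Let $k\geq 2$ and $n\geq 1$ be integers, let $t_1,\dots,t_k$ be indeterminates, and work in the field $\mathbb{C}(t_1,\dots,t_k)$ of rational functions. Set $t_0=1$. Let $L_{k,n}=(l_{rs})_{1\le r,s\le n}$ be the $n\times n$ lower Hessenberg matrix with $$l_{rs}=\begin{cases} \dfrac{t_{r-s+1}}{t_2^{\,r-s}} & \text{if } -1\leq r-s<k,\\[2mm] 0 & \text{otherwise.}\end{cases}$$ (Thus the superdiagonal entries are $t_2$, the diagonal entries are $t_1$, the subdiagonal entries are $1$, and the entries with $r-s=d$, $2\le d\le k-1$, are $t_{d+1}/t_2^{d}$.) Then $$\operatorname{per}(L_{k,n})=F_{k,n+1}(t),$$ where $\operatorname{per}(A)=\sum_{\sigma\in S_n}\prod_{r=1}^n a_{r,\sigma(r)}$ denotes the permanent.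
   Context: The generalized Fibonacci polynomials $F_{k,n}(t)$, $t=(t_1,\dots,t_k)$, are defined by $F_{k,n}(t)=0$ for $n<1$, $F_{k,1}(t)=1$, $F_{k,2}(t)=t_1$, and $F_{k,n+1}(t)=t_1F_{k,n}(t)+t_2F_{k,n-1}(t)+\cdots+t_kF_{k,n-k+1}(t)$ for $n\ge 1$. *)

(* Defs.v *)
From HB Require Import structures.
From mathcomp Require Import all_boot all_order all_algebra all_fingroup.
From mathcomp Require Import reals complex mpoly.
From mathcomp Require Import zify.

Set Implicit Arguments.
Unset Strict Implicit.
Unset Printing Implicit Defensive.

Import GRing.Theory Num.Theory.
Local Open Scope ring_scope.

Definition permanent (R : comNzRingType) (n : nat) (A : 'M[R]_n) : R :=
  \sum_(s : 'S_n) \prod_(r < n) A r (s r).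

Section GeneralizedFibonacci.
Variables (C : comNzRingType) (k : nat).
Implicit Types n : int.

(* The list [:: F_{k,m}; ...; F_{k,1}]. The variable t_{i+1} is 'X_i, and
   reading past the end of the list gives 0, that is, F_{k,j} with j < 1. *)
Fixpoint gfib_seq (m : nat) : seq {mpoly C[k]} :=
  match m with
  | 0 => [::]
  | 1 => [:: 1]
  | p.+1 => (\sum_(i < k) 'X_i * (gfib_seq p)`_i) :: gfib_seq p
  end.

Definition gfib n : {mpoly C[k]} :=
  if n is Posz m then (gfib_seq m)`_0 else 0.

Lemma gfib_lt1 n : n < 1 -> gfib n = 0.
Proof. by case: n => [[|m]|m]. Qed.

Lemma gfib1 : gfib 1 = 1.
Proof. by []. Qed.

Lemma gfib_seq_nth (m i : nat) : (gfib_seq m)`_i = gfib (m%:Z - i%:Z).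
Proof.
elim: m i => [|p IHp] [|i] /=.
- by [].
- by [].
- by rewrite addn0.
have -> : p.+1%:Z - i.+1%:Z = p%:Z - i%:Z by lia.
by rewrite -IHp; case: p {IHp}.
Qed.

Lemma gfib_rec n : 1 <= n -> gfib (n + 1) = \sum_(i < k) 'X_i * gfib (n - i%:Z).
Proof.
case: n => [[|m]|m] // _.
have -> : (m.+1%:Z + 1) = m.+2%:Z by lia.
transitivity (\sum_(i < k) 'X_i * (gfib_seq m.+1)`_i); first by [].
by apply: eq_bigr => i _; rewrite gfib_seq_nth.
Qed.

Lemma gfib2 (k_gt0 : (0 < k)%N) : gfib 2 = 'X_(Ordinal k_gt0).
Proof.
rewrite (gfib_rec (n := 1)) // (bigD1 (Ordinal k_gt0)) //= mulr1 big1 ?addr0 //.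
by move=> i ni0; rewrite gfib_lt1 ?mulr0 //; move: ni0; rewrite -val_eqE /=; lia.
Qed.

End GeneralizedFibonacci.

Section Hessenberg.
Variables (C : idomainType) (k : nat).

(* t_0 = 1 and t_1, ..., t_k are the indeterminates; the value 0 for j > k is
   never used. *)
Definition tvar (j : nat) : {fraction {mpoly C[k]}} :=
  if j is i.+1 then
    if insub i is Some o then tofrac 'X_(o : 'I_k) else 0
  else 1.

(* Indices start at 0 here, which leaves r - s unchanged. The exponent is an
   integer, equal to -1 on the superdiagonal. *)
Definition hessenberg (n : nat) : 'M[{fraction {mpoly C[k]}}]_n :=
  \matrix_(r < n, s < n)
    let d := (r : nat)%:Z - (s : nat)%:Z in
    if (-1 <= d) && (d < k%:Z) then tvar (absz (d + 1)) / tvar 2 ^ d else 0.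

End Hessenberg.

(* Main.v *)
(** Expanding along the first row shows that the permanent of a lower Hessenberg
    Toeplitz matrix whose first column [v] is arbitrary satisfies
    P(v, n+1) = v_0 P(a, n) + c P(v shifted, n), where [c] is the superdiagonal entry
    and [a] lists the entries on and below the diagonal. Unrolling this gives
    P(a, n+1) = sum_j a_j c^j P(a, n-j). For [L_{k,n}] we have [c = t_2] and
    [a_j = t_{j+1} / t_2^j], so the powers of [t_2] cancel and what is left is the
    recurrence of the generalized Fibonacci polynomials. *)
Require Import Defs.
From mathcomp Require Import all_boot all_order all_algebra all_fingroup.
From mathcomp Require Import reals complex mpoly.
From mathcomp Require Import zify.
Import GRing.Theory.
Local Open Scope ring_scope.

(** The inverse deletes row [i] and column [s i] from the permutation matrix of [s]. Row expansion
    uses this to reindex the permutations sending [i] to [j] by ['S_n]. *)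
Lemma lift_perm_bij_on (n : nat) (i j : 'I_n.+1) :
  {on [pred s : 'S_n.+1 | s i == j], bijective (lift_perm i j)}.
Proof.
pose u (s : 'S_n.+1) k := odflt k (unlift (s i) (s (lift i k))).
(* As [s] is injective, [s (lift i k)] differs from [s i], so the default of [odflt] is never
   taken. *)
have uK (s : 'S_n.+1) k : lift (s i) (u s k) = s (lift i k).
  rewrite /u; case: unliftP => // /perm_inj /eqP.
  by rewrite eq_sym (negPf (neq_lift _ _)).
have u_inj s : injective (u s).
  by move=> k l /(congr1 (lift (s i))); rewrite !uK => /perm_inj /lift_inj.
exists (fun s => perm (u_inj s)) => s.
  by move=> _; apply/permP => k; rewrite permE /u lift_perm_lift lift_perm_id liftK.
rewrite inE => /eqP si; apply/permP => l; case: (unliftP i l) => [k|] ->.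
  by rewrite lift_perm_lift permE -si uK.
by rewrite lift_perm_id.
Qed.

Lemma expand_permanent_row (R : comNzRingType) (n : nat) (A : 'M[R]_n.+1)
    (i : 'I_n.+1) :
  permanent A = \sum_j A i j * permanent (row' i (col' j A)).
Proof.
rewrite /permanent (partition_big (fun s : 'S_n.+1 => s i) xpredT) //=.
apply: eq_bigr => j _; rewrite (reindex _ (lift_perm_bij_on n i j)) big_distrr /=.
apply: eq_big => [s | s _]; first by rewrite lift_perm_id eqxx.
rewrite (bigD1_ord i) //= lift_perm_id; congr (_ * _).
by apply: eq_bigr => k _; rewrite !mxE lift_perm_lift.
Qed.

Section ToeplitzHessenberg.
Variables (R : comNzRingType) (c : R) (a : nat -> R).
Implicit Types (v : nat -> R) (n : nat).

(** The first column is kept free because deleting row 0 and column 1 leaves a matrix of the same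
    form, with [v] replaced by its shift. *)
Definition toep_hess v n : 'M[R]_n :=
  \matrix_(r < n, s < n)
    if s == 0%N :> nat then v r
    else if (s <= r)%N then a (r - s) else if s == r.+1 :> nat then c else 0.

Lemma permanent_toep_hess0 v : permanent (toep_hess v 0) = 1.
Proof.
rewrite /permanent (big_pred1 1%g) ?big_ord0 // => s.
by apply/esym/eqP/permP => - [].
Qed.

Lemma permanent_toep_hess1 v : permanent (toep_hess v 1) = v 0%N.
Proof.
rewrite (expand_permanent_row _ _ _ ord0) big_ord1 mxE /=.
rewrite -[RHS]mulr1 -(permanent_toep_hess0 v); congr (_ * permanent _).
by apply/matrixP => - [].
Qed.

Lemma permanent_toep_hess_shift v n :
  permanent (toep_hess v n.+2) =
  v 0%N * permanent (toep_hess a n.+1)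
  + c * permanent (toep_hess (v \o succn) n.+1).
Proof.
(* In the first row, only columns 0 and 1 can hold nonzero entries. *)
rewrite (expand_permanent_row _ _ _ ord0) 2!big_ord_recl big1 ?addr0; last first.
  by move=> i _; rewrite !mxE /= mul0r.
rewrite !mxE /=; congr (_ * _ + _ * _); congr permanent.
  apply/matrixP => r s; rewrite !mxE /= /bump !leq0n !add1n /= ltnS subSS.
  by case: s => [[|s] hs] //=; rewrite subn0.
by apply/matrixP => r [[|s] hs]; rewrite !mxE.
Qed.

Lemma permanent_toep_hess_sum v n :
  permanent (toep_hess v n.+1) =
  \sum_(j < n.+1) v j * c ^+ j * permanent (toep_hess a (n - j)).
Proof.
elim: n v => [|n IHn] v.
  by rewrite permanent_toep_hess1 big_ord1 permanent_toep_hess0 !mulr1.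
rewrite permanent_toep_hess_shift (IHn (v \o succn)).
rewrite [RHS]big_ord_recl /= expr0 mulr1 subn0; congr (_ + _).
rewrite big_distrr; apply: eq_bigr => j _ /=.
by rewrite /bump add1n subSS exprS !mulrA [c * _]mulrC.
Qed.

End ToeplitzHessenberg.

Section HessenbergPermanent.
Variables (C : idomainType) (k : nat).
Hypothesis k_ge2 : (2 <= k)%N.

Let a (j : nat) : {fraction {mpoly C[k]}} :=
  if (j < k)%N then tvar C k j.+1 / tvar C k 2 ^+ j else 0.

Lemma tvarS (i : 'I_k) : tvar C k i.+1 = tofrac 'X_i.
Proof. by rewrite /= valK. Qed.

Lemma tvar2_neq0 : tvar C k 2 != 0.
Proof.
rewrite (tvarS (Ordinal k_ge2)) tofrac_eq0.
apply/eqP => /(congr1 (mcoeff U_(Ordinal k_ge2))) /eqP.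
by rewrite mcoeffX mcoeff0 eqxx oner_eq0.
Qed.

Lemma hessenberg_toep n : hessenberg C k n = toep_hess _ (tvar C k 2) a a n.
Proof.
apply/matrixP => r s; rewrite !mxE.
case: (leqP s r) => [le_sr | lt_rs].
  have -> : (r : nat)%:Z - (s : nat)%:Z = (r - s)%N%:Z by lia.
  rewrite /a ltz_nat -PoszD addn1 /= -exprnP.
  by case: (s : nat) (r : nat) => [|s'] r'; rewrite ?subn0.
have -> : (s == 0%N :> nat) = false by lia.
case: eqP => [->|ne_sr].
  have -> : (r : nat)%:Z - r.+1%:Z = -1 by lia.
  by rewrite /= mul1r invrK.
by rewrite /= ifF //; lia.
Qed.

Lemma permanent_hessenberg n :
  permanent (hessenberg C k n) = tofrac (gfib C k (n%:Z + 1)).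
Proof.
rewrite hessenberg_toep; elim/ltn_ind: n => [[|n] IHn].
  by rewrite permanent_toep_hess0 gfib1 rmorph1.
rewrite permanent_toep_hess_sum gfib_rec // rmorph_sum /=.
(* Both sums are [\sum_j F j] over a range containing all nonzero terms. *)
pose F (j : nat) : {fraction {mpoly C[k]}} :=
  if (j < k)%N then tvar C k j.+1 * tofrac (gfib C k (n.+1%:Z - j%:Z)) else 0.
transitivity (\sum_(j < n.+1 + k) F j).
  (* For [j > n] the Fibonacci index [n + 1 - j] is below 1, so [F j] vanishes. *)
  rewrite big_split_ord /= [X in _ = _ + X]big1 ?addr0.
    apply: eq_bigr => j _; rewrite /F /a; case: ifP => _; last by rewrite !mul0r.
    rewrite divfK ?expf_neq0 ?tvar2_neq0 // IHn; last by lia.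
    by congr (_ * tofrac (gfib _ _ _)); have := ltn_ord j; lia.
  move=> j _; rewrite /F gfib_lt1 ?rmorph0 ?mulr0 ?if_same //; lia.
(* The same range is now split at [k]: the terms with [j >= k] vanish by the definition of [F]. *)
rewrite addnC big_split_ord /= [X in _ + X]big1 ?addr0.
  by apply: eq_bigr => i _; rewrite /F ltn_ord tvarS rmorphM.
by move=> j _; rewrite /F ltnNge leq_addr.
Qed.

End HessenbergPermanent.

Theorem theorem3p5 (R : realType) (k n : nat) (hk : (2 <= k)%N) (hn : (1 <= n)%N) :
  permanent (hessenberg R[i] k n) = tofrac (gfib R[i] k (n%:Z + 1)).
Proof. exact: permanent_hessenberg. Qed.
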